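(* Let $\mathcal{P}_A$ be an arrow space with arrow pre-inner product and scalar multiplication. Given any two distinct points $A$ and $B$ of $\mathcal{P}$, there exists a unique line containing $A$ and $B$, namely $l_{AB}$.
   Context: Let $\mathcal{P}$ be a set whose elements are called points. An arrow is an ordered pair of points $\overrightarrow{AB}=(A,B)$ (tail $A$, head $B$; $A=B$ is allowed). The arrow space $\mathcal{P}_A$ is the set of all arrows; two arrows are equal iff they have the same tail and the same head. Negation: $-\overrightarrow{AB}=\overrightarrow{BA}$. Arrow addition is the partial operation $\overrightarrow{AB}+_A\overrightarrow{BC}=\overrightarrow{AC}$, defined exactly when the head of the first arrow equals the tail of the second. Axiom 1: there is a given map (arrow pre-inner product) $\langle -,-\rangle_A:\mathcal{P}_A\times\mathcal{P}_A\to\mathbb{R}$ such that for all points: $\langle\overrightarrow{AB},\overrightarrow{AB}\rangle_A\ge 0$, with equality iff $A=B$; $\langle\overrightarrow{AB},\overrightarrow{CD}\rangle_A=\langle\overrightarrow{CD},\overrightarrow{AB}\rangle_A$; $\langle\overrightarrow{AB}+_A\overrightarrow{BC},\overrightarrow{LM}\rangle_A=\langle\overrightarrow{AB},\overrightarrow{LM}\rangle_A+\langle\overrightarrow{BC},\overrightarrow{LM}\rangle_A$; $\langle-\overrightarrow{AB},\overrightarrow{CD}\rangle_A=-\langle\overrightarrow{AB},\overrightarrow{CD}\rangle_A$. Measure: $\|\overrightarrow{AB}\|_A=\sqrt{\langle\overrightarrow{AB},\overrightarrow{AB}\rangle_A}$. Scalar multiplication: for $t\in\mathbb{R}$, if $A=B$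 or $t=0$ then $(t)\overrightarrow{AB}=\overrightarrow{AA}$. If $A\ne B$ and $t\neq0$ then $(t)\overrightarrow{AB}=\overrightarrow{AD}$, where $D\in\mathcal{P}$ is a point (assumed to exist) with $\|\overrightarrow{AD}\|_A=|t|\,\|\overrightarrow{AB}\|_A$ and $\langle\overrightarrow{AB},\overrightarrow{AD}\rangle_A=\|\overrightarrow{AB}\|_A\|\overrightarrow{AD}\|_A$ if $t>0$, $=-\|\overrightarrow{AB}\|_A\|\overrightarrow{AD}\|_A$ if $t<0$. Axiom 2: $\langle(t)\overrightarrow{AB},\overrightarrow{CD}\rangle_A=t\langle\overrightarrow{AB},\overrightarrow{CD}\rangle_A$ for all arrows and all $t\in\mathbb{R}$. Line: for distinct points $M,L$, $l_{ML}=\{C\in\mathcal{P}:\ \exists t\in\mathbb{R},\ \overrightarrow{MC}=(t)\overrightarrow{ML}\}$. A line is a subset of $\mathcal{P}$ of the form $l_{ML}$ for some distinct $M,L\in\mathcal{P}$. Axiom 3: for every line there is a one-to-one correspondence between $\mathbb{R}$ and the set of points on the line. *)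

(* Defs.v *)
From mathcomp Require Import all_boot all_order all_algebra.
From mathcomp Require Import classical_sets functions reals.

Set Implicit Arguments.
Unset Strict Implicit.
Unset Printing Implicit Defensive.

Import Order.TTheory GRing.Theory Num.Theory.
Local Open Scope classical_set_scope.
Local Open Scope ring_scope.

(* The pair (A, B) is the arrow with tail A and head B. *)
Definition arrow (P : Type) : Type := (P * P)%type.

Section ArrowSpace.
Variables (R : realType) (P : Type).
Implicit Types (u v w : arrow P) (A B C D L M : P) (t : R).

Definition tail u : P := u.1.
Definition head u : P := u.2.

Definition arrow_opp u : arrow P := (head u, tail u).

(* Addition is partial: it takes a proof that the two arrows are composable. *)
Definition arrow_add u v (uv : head u = tail v) : arrow P := (tail u, head v).

Record arrow_pre_inner_product (ip : arrow P -> arrow P -> R) : Prop := {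
  ip_ge0 : forall u, 0 <= ip u u;
  ip_eq0 : forall A B, ip (A, B) (A, B) = 0 <-> A = B;
  ip_sym : forall u v, ip u v = ip v u;
  ip_add : forall u v (uv : head u = tail v) w,
    ip (arrow_add uv) w = ip u w + ip v w;
  ip_opp : forall u w, ip (arrow_opp u) w = - ip u w
}.

Definition measure (ip : arrow P -> arrow P -> R) u : R := Num.sqrt (ip u u).

(* smul t (A, B) is the arrow (t)AB; the existence of the point D is part of
   the hypothesis, and smul selects one such point. *)
Record scalar_multiplication (ip : arrow P -> arrow P -> R)
    (smul : R -> arrow P -> arrow P) : Prop := {
  smul_degenerate : forall t A B, A = B \/ t = 0 -> smul t (A, B) = (A, A);
  smul_nondegenerate : forall t A B, A <> B -> t <> 0 ->
    exists D, [/\ smul t (A, B) = (A, D),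
      measure ip (A, D) = `|t| * measure ip (A, B),
      0 < t -> ip (A, B) (A, D) = measure ip (A, B) * measure ip (A, D)
    & t < 0 -> ip (A, B) (A, D) = - (measure ip (A, B) * measure ip (A, D))]
}.

Definition ip_homogeneous (ip : arrow P -> arrow P -> R)
    (smul : R -> arrow P -> arrow P) : Prop :=
  forall t u w, ip (smul t u) w = t * ip u w.

(* l_ML; it is only called a line when M and L are distinct (see is_line). *)
Definition line (smul : R -> arrow P -> arrow P) M L : set P :=
  [set C | exists t, (M, C) = smul t (M, L)].

Definition is_line (smul : R -> arrow P -> arrow P) (l : set P) : Prop :=
  exists M L, M <> L /\ l = line smul M L.

Definition lines_biject_with_reals (smul : R -> arrow P -> arrow P) : Prop :=
  forall l, is_line smul l -> exists f : R -> P, set_bij [set: R] l f.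

End ArrowSpace.

(* Main.v *)
Require Import Defs.
From mathcomp Require Import all_boot all_order all_algebra.
From mathcomp Require Import classical_sets functions reals.
From mathcomp Require Import boolp ring.

(** An arrow [u] with given tail is determined by the functional [ip u]:
    if [ip (A, B) = 0] then [A = B] by definiteness.  Hence [C] lies on
    [line M L] iff [ip (M, C)] is a multiple of [ip (M, L)], and membership in a
    line becomes linear algebra in one variable: if [ip (M, A)] and [ip (M, B)]
    are [a] and [b] times [ip (M, L)], then [ip (A, B)] is [b - a] times it, with
    [b - a] nonzero when [A <> B], so that [ip (M, L)] and [ip (A, B)] have the
    same multiples. *)

Import GRing.Theory.
Local Open Scope ring_scope.

Section ArrowSpaceTheory.
Variables (R : realType) (P : Type).
Variables (ip : arrow P -> arrow P -> R) (smul : R -> arrow P -> arrow P).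
Hypothesis ax_ip : arrow_pre_inner_product ip.

Lemma ip_chasles A B C w : ip (A, C) w = ip (A, B) w + ip (B, C) w.
Proof. exact: (ip_add ax_ip (u := (A, B)) (v := (B, C)) erefl w). Qed.

Lemma ip_sub A B C w : ip (B, C) w = ip (A, C) w - ip (A, B) w.
Proof. by rewrite (ip_chasles A B C) addrAC subrr add0r. Qed.

Lemma ip_head_inj A B C : (forall w, ip (A, B) w = ip (A, C) w) -> B = C.
Proof.
by move=> eq_ip; apply/(ip_eq0 ax_ip); rewrite (ip_sub A) eq_ip subrr.
Qed.

Hypothesis ax_smul : scalar_multiplication ip smul.
Hypothesis ax_hom : ip_homogeneous ip smul.

(** Once the tail is known, [ax_hom] and [ip_head_inj] determine the head; this is all that [lineP]
    takes from the definition of [smul]. *)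
Lemma smul_tail t A B : exists D, smul t (A, B) = (A, D).
Proof.
have [dgn|ndgn] := pselect (A = B \/ t = 0).
  by exists A; apply: smul_degenerate ax_smul _ _ _ dgn.
have neqAB : A <> B by move=> eqAB; apply: ndgn; left.
have t_neq0 : t <> 0 by move=> t0; apply: ndgn; right.
by have [D [eqD _ _ _]] := smul_nondegenerate ax_smul neqAB t_neq0; exists D.
Qed.

Lemma lineP M L C :
  line smul M L C <-> exists t, forall w, ip (M, C) w = t * ip (M, L) w.
Proof.
split=> [[t eqC]|[t ipC]]; exists t; first by move=> w; rewrite eqC ax_hom.
have [D eqD] := smul_tail t M L.
rewrite eqD; congr pair; apply: (ip_head_inj M) => w.
by rewrite ipC -eqD ax_hom.
Qed.

Lemma line_base M L : line smul M L M.
Proof. by apply/lineP; exists 0 => w; rewrite (ip_sub M) subrr mul0r. Qed.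

Lemma line_end M L : line smul M L L.
Proof. by apply/lineP; exists 1 => w; rewrite mul1r. Qed.

Lemma line_through M L A B : A <> B ->
  line smul M L A -> line smul M L B -> line smul M L = line smul A B.
Proof.
move=> neqAB /lineP[a ipA] /lineP[b ipB].
have ipAB w : ip (A, B) w = (b - a) * ip (M, L) w.
  by rewrite (ip_sub M) ipA ipB mulrBl.
have ba_neq0 : b - a != 0.
  apply/eqP => ba0; apply: neqAB; apply/(ip_eq0 ax_ip).
  by rewrite ipAB ba0 mul0r.
apply/funext => C; apply/propext; split=> /lineP[t ipC]; apply/lineP.
(* Based at [A], the point [C] has coordinate [t - a] in units of [(M, L)]; dividing by [b - a]
   changes the unit to [(A, B)]. *)
- by exists ((t - a) / (b - a)) => w; rewrite (ip_sub M) ipC ipA ipAB; field.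
(* Conversely, go from [M] to [A], which contributes [a], then from [A] to [C], which is [t] times
   [b - a]. *)
- exists (a + t * (b - a)) => w.
  by rewrite (ip_chasles M A) ipA ipC ipAB; ring.
Qed.

End ArrowSpaceTheory.

Theorem theorem33 (R : realType) (P : Type)
    (ip : arrow P -> arrow P -> R) (smul : R -> arrow P -> arrow P)
    (ax_ip : arrow_pre_inner_product ip)
    (ax_smul : scalar_multiplication ip smul)
    (ax_hom : ip_homogeneous ip smul)
    (ax_bij : lines_biject_with_reals smul)
    (A B : P) (neqAB : A <> B) :
  (exists! l : set P, [/\ is_line smul l, l A & l B]) /\
  [/\ is_line smul (line smul A B), line smul A B A & line smul A B B].
Proof.
have lineAB : [/\ is_line smul (line smul A B), line smul A B A
                & line smul A B B].
  split; first by exists A, B.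
  - exact: line_base ax_ip ax_smul ax_hom _ _.
  - exact: line_end ax_ip ax_smul ax_hom _ _.
(* For uniqueness, any competing line has the form [line smul M L], and [line_through] rebases it at
   [A] and [B]. *)
split=> //; exists (line smul A B); split=> // l [[M [L [_ ->]]] lA lB].
by apply: esym; exact: line_through ax_ip ax_smul ax_hom _ _ _ _ neqAB lA lB.
Qed.
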